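(* Let $r\in(2,\infty)$. Then the self-similar set $C^r\subset\mathbb{R}^2$ is not pluriphase with respect to $\Gamma=\big((0,1)\times(0,1)\big)\setminus \mathbf{S}^r\big((0,1)\times(0,1)\big)$.
   Context: For a real number $r>2$ let $S^r_1,S^r_2,S^r_3,S^r_4:\mathbb{R}^2\to\mathbb{R}^2$ be the similarities $$S^r_1(x)=\tfrac{1}{r}x,\quad S^r_2(x)=\tfrac{1}{r}x+\begin{pmatrix}\frac{r-1}{r}\\0\end{pmatrix},\quad S^r_3(x)=\tfrac{1}{r}x+\begin{pmatrix}\frac{r-1}{r}\\\frac{r-1}{r}\end{pmatrix},\quad S^r_4(x)=\tfrac{1}{r}x+\begin{pmatrix}0\\\frac{r-1}{r}\end{pmatrix}.$$ For $A\subseteq\mathbb{R}^2$ put $\mathbf{S}^r A:=\bigcup_{i=1}^4 S^r_i(A)$. $C^r$ denotes the self-similar attractor of $\{S^r_1,S^r_2,S^r_3,S^r_4\}$, i.e. the unique non-empty compact set $C^r\subset\mathbb{R}^2$ with $C^r=\mathbf{S}^r C^r$. For a non-empty compact set $A\subset\mathbb{R}^d$ (Euclidean norm $\|\cdot\|$) and $\varepsilon>0$, the $\varepsilon$-parallel set is $A_\varepsilon:=\{x\in\mathbb{R}^d\mid\min_{a\in A}\|x-a\|\le\varepsilon\}$; $\lambda^d$ is $d$-dimensional Lebesgue measure and $\mathds{1}_B$ is the indicator function of a set $B$. Pluriphase: Let $F\subset\mathbb{R}^d$ be the attractor of an iterated function system of contractive similarities $S_1,\dots,S_N$, and let $\mathbf{S}A:=\bigcup_{i=1}^N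 S_i(A)$. Let $\mathcal{O}$ be a feasible open set, i.e. a non-empty bounded open set such that the sets $S_i(\mathcal{O})$ are pairwise disjoint and contained in $\mathcal{O}$. Assume $F$ is non-trivial, meaning that $\mathcal{O}\not\subseteq\overline{\mathbf{S}\mathcal{O}}$ for some feasible open set $\mathcal{O}$ (equivalently, $F$ has empty interior). For a fixed feasible open set $\mathcal{O}$ put $\Gamma:=\mathcal{O}\setminus\mathbf{S}\mathcal{O}$ and $g:=\sup_{x\in\Gamma}\min_{y\in F}\|x-y\|$. Then $F$ is called pluriphase with respect to $\Gamma$ if there exist a finite partition $0=a_0<a_1<\dots<a_M=g<\infty$ and constants $\kappa_{m,k}\in\mathbb{R}$, $m=1,\dots,M$, $k=0,\dots,d$, such that for all $\varepsilon>0$ $$\lambda^d(F_\varepsilon\cap\Gamma)=\sum_{m=1}^M\mathds{1}_{(a_{m-1},a_m]}(\varepsilon)\sum_{k=0}^d\kappa_{m,k}\,\varepsilon^{d-k}+\mathds{1}_{(g,\infty)}(\varepsilon)\,\lambda^d(\Gamma).$$ In the claim this is applied with $d=2$, $F=C^r$, the iterated function system $\{S^r_1,\dots,S^r_4\}$, and the feasible open set $\mathcal{O}=(0,1)\times(0,1)$. *)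

(* Defs.v *)
From HB Require Import structures.
From mathcomp Require Import all_boot all_order all_algebra.
From mathcomp Require Import ring lra.
From mathcomp Require Import all_classical all_reals all_analysis.

Set Implicit Arguments.
Unset Strict Implicit.
Unset Printing Implicit Defensive.

Import Order.TTheory GRing.Theory Num.Theory.
Import numFieldNormedType.Exports.

Local Open Scope classical_set_scope.
Local Open Scope ring_scope.

(* The library norm on [R * R] is the max norm, which induces the same
   topology but not the same parallel sets. *)
Definition eucl_norm (R : realType) (x : R * R) : R :=
  Num.sqrt (x.1 ^+ 2 + x.2 ^+ 2).

(* On a non-empty compact set this infimum is a minimum, see
   [eucl_dist_attained]. *)
Definition eucl_dist (R : realType) (x : R * R) (A : set (R * R)) : R :=
  inf [set eucl_norm (x - a) | a in A].

Definition parallel_set (R : realType) (A : set (R * R)) (e : R) :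
    set (R * R) :=
  [set x | eucl_dist x A <= e].

Definition lebesgue2 (R : realType) : set (R * R) -> \bar R :=
  (@lebesgue_measure R \x @lebesgue_measure R)%E.

Definition ifs_union (T : Type) (N : nat) (S : 'I_N -> T -> T) (A : set T) :
    set T :=
  \bigcup_(i in [set: 'I_N]) (S i @` A).

Definition attractor (R : realType) (N : nat)
    (S : 'I_N -> R * R -> R * R) (F : set (R * R)) : Prop :=
  [/\ F !=set0, compact F & F = ifs_union S F].

Definition feasible_open (R : realType) (N : nat)
    (S : 'I_N -> R * R -> R * R) (O : set (R * R)) : Prop :=
  [/\ O !=set0, open O, bounded_set O,
      forall i, S i @` O `<=` O
    & forall i j, i != j -> (S i @` O) `&` (S j @` O) = set0].

(* [g] is taken in the extended reals, so that [(a M)%:E = g] also expresses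
   that [g] is finite. *)
Definition pluriphase (R : realType) (F Gamma : set (R * R)) : Prop :=
  let g : \bar R := ereal_sup [set (eucl_dist x F)%:E | x in Gamma] in
  exists (M : nat) (a : nat -> R) (kappa : nat -> nat -> R),
    [/\ (0 < M)%N, a 0%N = 0,
        forall m, (m < M)%N -> a m < a m.+1,
        (a M)%:E = g
      & forall e : R, 0 < e ->
          lebesgue2 (parallel_set F e `&` Gamma) =
          ((\sum_(1 <= m < M.+1) \1_(`]a m.-1, a m]%classic) e *
              \sum_(0 <= k < 3) kappa m k * e ^+ (2 - k))%:E
           + (\1_(`]a M, +oo[%classic) e)%:E * lebesgue2 Gamma)%E].

Definition dust_map (R : realType) (r : R) (i : 'I_4) (x : R * R) : R * R :=
  let t := (r - 1) / r in
  let b := nth (0, 0) [:: (0, 0); (t, 0); (t, t); (0, t)] i in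
  (r^-1 * x.1 + b.1, r^-1 * x.2 + b.2).

Definition open_unit_square (R : realType) : set (R * R) :=
  `]0, 1[%classic `*` `]0, 1[%classic.

Arguments open_unit_square : clear implicits.

Lemma eucl_dist_attained (R : realType) (x : R * R) (A : set (R * R)) :
  A !=set0 -> compact A ->
  exists2 a, A a & eucl_dist x A = eucl_norm (x - a) /\
                   forall b, A b -> eucl_norm (x - a) <= eucl_norm (x - b).
Proof.
move=> A0 cA; have cf : continuous (fun a : R * R => eucl_norm (x - a)).
  move=> a; apply: (@continuous_comp _ _ _
    (fun b : R * R => (x.1 - b.1) ^+ 2 + (x.2 - b.2) ^+ 2) Num.sqrt) => /=.
    have c1 : {for a, continuous (fun b : R * R => x.1 - b.1)}.
      by apply: cvgB; [exact: cvg_cst|exact: cvg_fst].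
    have c2 : {for a, continuous (fun b : R * R => x.2 - b.2)}.
      by apply: cvgB; [exact: cvg_cst|exact: cvg_snd].
    apply: cvgD.
      exact: (cvgM c1 c1).
    exact: (cvgM c2 c2).
  exact: sqrt_continuous.
have [|a Aa amin] := @compact_EVT_min (R * R)%type R
    (fun a : R * R => eucl_norm (x - a)) A A0 cA.
  exact: continuous_subspaceT.
rewrite inE in Aa; exists a => //; split; last first.
  by move=> b Ab; apply: amin; rewrite inE.
have lbA : lbound [set eucl_norm (x - b) | b in A] (eucl_norm (x - a)).
  by move=> _ [b Ab <-]; apply: amin; rewrite inE.
apply/eqP; rewrite eq_le; apply/andP; split.
  by apply: ge_inf; [exists (eucl_norm (x - a))|exists a].
by apply: lb_le_inf => //; exists (eucl_norm (x - a)), a.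
Qed.

Lemma open_box (R : realType) (a b : R) :
  open (`]a, b[%classic `*` `]a, b[%classic : set (R * R)).
Proof.
rewrite (_ : _ `*` _ = (fst @^-1` `]a, b[) `&` (snd @^-1` `]a, b[))//.
apply: openI; (apply: open_comp; last exact: interval_open) => z _.
- exact: cvg_fst.
- exact: cvg_snd.
Qed.

Lemma unit_square_feasible (R : realType) (r : R) :
  2 < r -> feasible_open (dust_map r) (open_unit_square R).
Proof.
move=> r2; have r0 : 0 < r by lra.
have ri0 : 0 < r^-1 by rewrite invr_gt0.
have ri2 : r^-1 < 2^-1 by rewrite ltf_pV2 ?posrE.
have tE : (r - 1) / r = 1 - r^-1 by field; lra.
split.
- by exists (2^-1, 2^-1); split; rewrite /= in_itv /=; apply/andP; split; lra.
- exact: open_box.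
- exists 1; split => // M M1 [x y] /= [].
  rewrite /= !in_itv /= => /andP[x0 x1] /andP[y0 y1].
  by rewrite ge_max /= !ger0_norm ?(ltW x0) ?(ltW y0)//; apply/andP; split; lra.
- move=> i _ [[x y] /= [+ +] <-]; rewrite /= !in_itv /= => /andP[x0 x1] /andP[y0 y1].
  have := mulr_gt0 ri0 x0; have := mulr_gt0 ri0 y0.
  have : r^-1 * x < r^-1 by rewrite gtr_pMr.
  have : r^-1 * y < r^-1 by rewrite gtr_pMr.
  rewrite /dust_map /= tE; move: (r^-1 * x) (r^-1 * y) => u v.
  case: i => -[|[|[|[|//]]]] ? /= *; split => /=;
    rewrite in_itv /=; apply/andP; split; lra.
- move=> i j ij; rewrite -subset0 => _ [[[x y] /= [+ +] <-] [[x' y'] /= [+ +]]].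
  rewrite /= !in_itv /= => /andP[x0 x1] /andP[y0 y1] /andP[x0' x1'] /andP[y0' y1'].
  have := mulr_gt0 ri0 x0; have := mulr_gt0 ri0 y0.
  have := mulr_gt0 ri0 x0'; have := mulr_gt0 ri0 y0'.
  have : r^-1 * x < r^-1 by rewrite gtr_pMr.
  have : r^-1 * y < r^-1 by rewrite gtr_pMr.
  have : r^-1 * x' < r^-1 by rewrite gtr_pMr.
  have : r^-1 * y' < r^-1 by rewrite gtr_pMr.
  rewrite /dust_map /= tE.
  move: (r^-1 * x) (r^-1 * y) (r^-1 * x') (r^-1 * y') => u v u' v'.
  case: i j ij => -[|[|[|[|//]]]] ? [[|[|[|[|//]]]] ?] //= _ *;
    match goal with H : (_, _) = (_, _) |- _ => case: H => * end; lra.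
Qed.

Lemma dust_nontrivial (R : realType) (r : R) : 2 < r ->
  ~ (open_unit_square R `<=`
     closure (ifs_union (dust_map r) (open_unit_square R))).
Proof.
move=> r2; have r0 : 0 < r by lra.
have ri0 : 0 < r^-1 by rewrite invr_gt0.
have ri2 : r^-1 < 2^-1 by rewrite ltf_pV2 ?posrE.
have tE : (r - 1) / r = 1 - r^-1 by field; lra.
pose c : R * R := (2^-1, 2^-1).
have cO : open_unit_square R c.
  by split; rewrite /= in_itv /=; apply/andP; split; lra.
move=> /(_ _ cO)/(_ (`]r^-1, 1 - r^-1[%classic `*` `]r^-1, 1 - r^-1[%classic)).
case=> [|z [[i _ [[x y] /= []]]]].
  apply: open_nbhs_nbhs; split; first exact: open_box.
  by split; rewrite /= in_itv /=; apply/andP; split; lra.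
rewrite /= !in_itv /= => /andP[x0 x1] /andP[y0 y1] <- [].
have := mulr_gt0 ri0 x0; have := mulr_gt0 ri0 y0.
have : r^-1 * x < r^-1 by rewrite gtr_pMr.
have : r^-1 * y < r^-1 by rewrite gtr_pMr.
rewrite /dust_map /= tE; move: (r^-1 * x) (r^-1 * y) => u v.
by case: i => -[|[|[|[|//]]]] ? /= ? ? ? ? =>
  /andP[? ?] /andP[? ?]; lra.
Qed.

Lemma dust_attractor_exists (R : realType) (r : R) :
  2 < r -> exists C : set (R * R), attractor (dust_map r) C.
Proof.
move=> r2; have r0 : 0 < r by lra.
have rn0 : r != 0 by lra.
have ri0 : 0 < r^-1 by rewrite invr_gt0.
have ri2 : r^-1 < 2^-1 by rewrite ltf_pV2 ?posrE.
have tE : (r - 1) / r = 1 - r^-1 by field; lra.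
pose Q : set (R * R) := `[0, 1]%classic `*` `[0, 1]%classic.
pose H := ifs_union (dust_map r).
pose K n := iter n H Q.
have HS A B : A `<=` B -> H A `<=` H B.
  by move=> AB z [i _ [x Ax <-]]; exists i => //; exists x => //; exact: AB.
have K1 : K 1%N `<=` K 0%N.
  move=> _ [i _ [[x y] /= [+ +] <-]].
  rewrite /= !in_itv /= => /andP[x0 x1] /andP[y0 y1].
  have := mulr_ge0 (ltW ri0) x0; have := mulr_ge0 (ltW ri0) y0.
  have : r^-1 * x <= r^-1 by rewrite ger_pMr.
  have : r^-1 * y <= r^-1 by rewrite ger_pMr.
  rewrite /dust_map /= tE; move: (r^-1 * x) (r^-1 * y) => u v.
  case: i => -[|[|[|[|//]]]] ? /= *; split => /=;
    rewrite in_itv /=; apply/andP; split; lra.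
have KS n : K n.+1 `<=` K n by elim: n => // n IH; exact: HS.
have KQ n : K n `<=` Q by elim: n => // n IH; apply: subset_trans (KS n) IH.
pose b i : R * R := nth (0, 0)
  [:: (0, 0); ((r - 1) / r, 0); ((r - 1) / r, (r - 1) / r); (0, (r - 1) / r)] i.
pose g (i : 'I_4) (z : R * R) : R * R := (r * (z.1 - (b i).1), r * (z.2 - (b i).2)).
have gK i x : g i (dust_map r i x) = x.
  case: x => x y; rewrite /g /dust_map /= -/(b i) /=.
  by rewrite !addrK !mulrA divff// !mul1r.
have Kg i z : dust_map r i (g i z) = z.
  case: z => x y; rewrite /g /dust_map /= -/(b i) /=.
  by rewrite !mulrA mulVf// !mul1r !subrK.
have cg i : continuous (g i).
  move=> z.
  have c1 : {for z, continuous (fun w : R * R => r * (w.1 - (b i).1))}.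
    by apply: cvgM; [exact: cvg_cst|apply: cvgB; [exact: cvg_fst|exact: cvg_cst]].
  have c2 : {for z, continuous (fun w : R * R => r * (w.2 - (b i).2))}.
    by apply: cvgM; [exact: cvg_cst|apply: cvgB; [exact: cvg_snd|exact: cvg_cst]].
  exact: (cvg_pair c1 c2).
have Hcl A : closed A -> closed (H A).
  move=> cA; apply: closed_bigcup => [|i _]; first exact: finite_finset.
  rewrite (_ : _ @` _ = g i @^-1` A); first by apply: preimage_closed => // z _; exact: cg.
  by apply/seteqP; split => [_ [x Ax <-]|z Az] /=; rewrite ?gK//; exists (g i z).
have QQ : compact Q by apply: compact_setX; exact: segment_compact.
have Qcl : closed Q.
  rewrite /Q (_ : _ `*` _ = (fst @^-1` `[0, 1]) `&` (snd @^-1` `[0, 1]))//.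
  apply: closedI; (apply: preimage_closed; last exact: interval_closed) => z _.
  + exact: cvg_fst.
  + exact: cvg_snd.
have Kcl n : closed (K n) by elim: n => // n IH; exact: Hcl.
exists (\bigcap_n K n); split.
- exists 0 => n _; elim: n => [|n IH].
    by split; rewrite /= in_itv /= lexx ler01.
  exists ord0 => //; exists 0 => //.
  by rewrite /dust_map /= !mulr0 !addr0.
- apply: subclosed_compact QQ _; last by move=> z /(_ 0%N I).
  exact: closed_bigI.
- apply/seteqP; split => [z Kz|_ [i _ [x Kx <-]] n _]; last first.
    by apply: (KS n); exists i => //; exists x => //; exact: Kx.
  have [i _ [x Qx xz]] := Kz 1%N I.
  exists i => //; exists x => // n _.
  have [j _ [y Ky yz]] := Kz n.+1 I.
  suff ij : i = j by rewrite -(gK i x) xz -yz ij gK.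
  have := KQ _ _ Ky; move: Qx xz; rewrite -yz.
  case: x => x x'; case: y {Ky yz} => y y' /= [+ +] + [+ +].
  rewrite /= !in_itv /= => /andP[x0 x1] /andP[x0' x1'] + /andP[y0 y1] /andP[y0' y1'].
  have := mulr_ge0 (ltW ri0) x0; have := mulr_ge0 (ltW ri0) x0'.
  have := mulr_ge0 (ltW ri0) y0; have := mulr_ge0 (ltW ri0) y0'.
  have : r^-1 * x <= r^-1 by rewrite ger_pMr.
  have : r^-1 * x' <= r^-1 by rewrite ger_pMr.
  have : r^-1 * y <= r^-1 by rewrite ger_pMr.
  have : r^-1 * y' <= r^-1 by rewrite ger_pMr.
  rewrite /dust_map /= tE.
  move: (r^-1 * x) (r^-1 * x') (r^-1 * y) (r^-1 * y') => u u' v v'.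
  case: i j => -[|[|[|[|//]]]] ? [[|[|[|[|//]]]] ?] /= *; apply: val_inj => //=;
    exfalso;
    match goal with H : (_, _) = (_, _) |- _ => case: H => * end; lra.
Qed.

(* Main.v *)
Require Import Defs.
From mathcomp Require Import all_boot all_order all_algebra.
From mathcomp Require Import ring lra.
From mathcomp Require Import all_classical all_reals all_analysis.

Set Implicit Arguments.
Unset Strict Implicit.
Unset Printing Implicit Defensive.

Import Order.TTheory GRing.Theory Num.Theory.
Import numFieldNormedType.Exports.

Local Open Scope classical_set_scope.
Local Open Scope ring_scope.

(** Write q = 1/r, so 0 < q < 1/2.  As e tends to 0, the area of the part of the
    gap Gamma within e of C^r has order of magnitude e^(2 - D), where
    D = log_r 2 is the dimension of the Cantor set of ratio q on the line.  Since
    0 < D < 1, the exponent lies strictly between 1 and 2, and no function of the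
    form k0 e^2 + k1 e + k2 behaves like that.  A pluriphase set, on the other
    hand, has exactly such an area for e in its first interval (0, a_1]
    ([pluriphase_near0]).

    The reason for the exponent is that Gamma touches C^r only along the sides
    of the central cross: Gamma is the square minus the product of two copies of
    (0, q) U (1 - q, 1), so one coordinate of a point of Gamma lies in
    [q, 1 - q], while both coordinates of a point of C^r avoid the open interval
    (q, 1 - q).  The part of C^r on the line x_1 = q is a Cantor set, which at
    scale q^n looks like 2^n intervals of length q^n.

    It is enough to look at e = 2u with u = q^n, that is, at a geometric sequence
    of scales, and to bound the area there within constants.
    - From below ([parallel_gap_area_ge]): C^r contains the points (q, a) where a
      runs through the 2^n left endpoints of the n-th stage of the Cantor
      construction, and the open squares of side u with lower left corner (q, a)
      are disjoint, lie in Gamma and are within 2u of C^r.  So the area is at least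
      2^n u^2.
    - From above ([parallel_gap_area_le]): a point of Gamma within 2u of C^r has
      one coordinate within 2u of q or 1 - q, and the other within 2u of one of
      the 2^n intervals of the n-th stage.  So the area is at most 80 2^n u^2.
    As 2^n u = (2q)^n tends to 0 while 2^n tends to infinity, the upper bound
    forces k2 = k1 = 0 and then the lower bound gives 2^n <= 4 k0 for all large n
    ([quadratic_not_between]). *)

Local Notation dust_gap r :=
  (open_unit_square _ `\` ifs_union (dust_map r) (open_unit_square _)).

(** * Planar Lebesgue measure *)

Lemma lebesgue2X (R : realType) (A B : set (measurableTypeR R)) :
  measurable A -> measurable B ->
  lebesgue2 (A `*` B) = (lebesgue_measure A * lebesgue_measure B)%E.
Proof. exact: product_measure1E. Qed.

(** An open set of the plane is the union of the squares with rational centre and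
    size that it contains, and these are countably many rectangles. *)
Lemma open_measurable2 (R : realType) (U : set (measurableTypeR R * measurableTypeR R)) :
  @open (R * R)%type U -> measurable U.
Proof.
move=> oU.
pose box (c : rat * rat * rat) : set (R * R) :=
  ball (ratr c.1.1 : R) (ratr c.2 : R) `*` ball (ratr c.1.2 : R) (ratr c.2 : R).
rewrite (_ : U = \bigcup_(c in [set: rat * rat * rat])
    (if `[< box c `<=` U >] then box c else set0)); last first.
  apply/seteqP; split => [[x y] Uxy|z [c _]]; last first.
    by case: asboolP => // + cz; apply.
  move: oU; rewrite openE => /(_ _ Uxy) /nbhs_ballP[e /= e0 eU].
  have [d /itvP de] : exists d : rat, ratr d \in `]0, e / 2[.
    by have /rat_in_itvoo : 0 < e / 2 by rewrite divr_gt0.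
  have d0 : 0 < ratr d :> R by rewrite de.
  have dense z : exists p : rat, ball z (ratr d : R) (ratr p : R).
    have /rat_in_itvoo[p /itvP pz] : z < z + ratr d by rewrite ltrDl.
    exists p; rewrite /ball /= distrC ger0_norm ?subr_ge0 ?pz//.
    by rewrite ltrBlDl pz.
  have [[p xp] [q yq]] := (dense x, dense y).
  exists (p, q, d) => //; case: asboolP => [_|[]].
    by split; exact: ball_sym.
  case=> u v [/= pu qv]; apply: eU.
  split; apply: (@le_ball _ _ _ (ratr d + ratr d)).
  1, 3: by rewrite (splitr e) lerD// ltW// de.
  - exact: ball_triangle pu.
  - exact: ball_triangle qv.
apply: countable_bigcupT_measurable => [|c]; first exact: countableP.
case: asboolP => // _.
by apply: measurableX; rewrite ball_itv; exact: measurable_itv.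
Qed.

Lemma mem_bigsetU_seq (T : Type) (I : choiceType) (s : seq I) (F : I -> set T) a x :
  a \in s -> F a x -> (\big[setU/set0]_(b <- s) F b) x.
Proof. by move=> aS Fx; rewrite -bigcup_seq; exists a. Qed.

Lemma measurable_bigsetU_seq d (T : measurableType d) (I : Type) (s : seq I)
    (F : I -> set T) :
  (forall a, measurable (F a)) -> measurable (\big[setU/set0]_(a <- s) F a).
Proof. by move=> mF; elim/big_ind: _ => //; exact: measurableU. Qed.

Lemma measure_bigsetU_seq_le d (T : measurableType d) (R : realType)
    (mu : {measure set T -> \bar R}) (I : Type) (s : seq I) (F : I -> set T) (m : R) :
  (forall a, measurable (F a)) -> (forall a, (mu (F a) <= m%:E)%E) ->
  (mu (\big[setU/set0]_(a <- s) F a) <= ((size s)%:R * m)%:E)%E.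
Proof.
move=> mF Fm; elim: s => [|a s IH]; first by rewrite big_nil measure0 mul0r.
rewrite big_cons; apply: le_trans (measureU2 _ (mF a) (measurable_bigsetU_seq s mF)) _.
by rewrite /= -natr1 mulrDl mul1r addrC EFinD leeD.
Qed.

Lemma lebesgue_separated_itv (R : realType) (u : R) (s : seq R) :
  0 < u -> pairwise (fun a b => a + u <= b) s ->
  lebesgue_measure (\big[setU/set0]_(a <- s) `]a, a + u[%classic) =
    ((size s)%:R * u)%:E.
Proof.
move=> u0; elim: s => [|a s IH]; first by rewrite big_nil measure0 mul0r.
rewrite pairwise_cons => /andP[/allP as_ /IH{}IH].
have disj : `]a, a + u[%classic `&` \big[setU/set0]_(b <- s) `]b, b + u[%classic = set0.
  rewrite -subset0 => x [/= + xs]; rewrite in_itv /= => /andP[_ xa].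
  move: xs; rewrite -bigcup_seq => -[b /= /as_ ab]; rewrite in_itv /= => /andP[bx _].
  lra.
have ms : measurable
    (\big[setU/set0]_(b <- s) `]b, b + u[%classic : set (measurableTypeR R)).
  by apply: measurable_bigsetU_seq => b; exact: measurable_itv.
have mu_a : lebesgue_measure `]a, a + u[%classic = u%:E.
  by rewrite lebesgue_measure_itv /= lte_fin ltrDl u0 -EFinD addrAC subrr add0r.
rewrite big_cons; transitivity (lebesgue_measure `]a, (a + u)%R[%classic +
    lebesgue_measure (\big[setU/set0]_(b <- s) `]b, (b + u)%R[%classic))%E.
  by apply: measureU => //; exact: measurable_itv.
by rewrite mu_a IH -EFinD -natr1; congr EFin; ring.
Qed.

(** * Quadratic polynomials along a geometric sequence *)

(** Along u = q^n the quantity 2^n u^2 is o(u), as 2 q < 1, but it is not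
    O(u^2).  A quadratic polynomial comparable to it would have vanishing
    constant and linear coefficients, and would then be O(u^2). *)
Lemma quadratic_not_between (R : realType) (q A B k0 k1 k2 : R) :
  0 < q -> q < 2^-1 -> 0 < B ->
  (\forall n \near \oo,
    B * 2 ^+ n * (q ^+ n) ^+ 2 <=
      k0 * (q ^+ n) ^+ 2 + k1 * q ^+ n + k2 <= A * 2 ^+ n * (q ^+ n) ^+ 2) ->
  False.
Proof.
move=> q0 q2 B0 bnd.
pose u n : R := q ^+ n; pose v n : R := (2 * q) ^+ n.
have vE n : v n = 2 ^+ n * u n by rewrite /v exprMn.
have u0 n : 0 < u n by rewrite exprn_gt0.
have p0 n : 0 < 2 ^+ n :> R by rewrite exprn_gt0.
have v0 n : 0 < v n by rewrite vE mulr_gt0.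
have cu : u @ \oo --> (0 : R) by apply: cvg_expr; rewrite gtr0_norm//; lra.
have cv : v @ \oo --> (0 : R) by apply: cvg_expr; rewrite gtr0_norm; lra.
have cst_lim (k : R) : (fun=> k) @ \oo --> k by exact: cvg_cst.
(* The polynomial is squeezed between 0 and A (2q)^n q^n, so its limit is 0. *)
have k2E : k2 = 0.
  apply: (@cvg_unique _ (@norm_hausdorff _ R)
    ((fun n => k0 * u n ^+ 2 + k1 * u n + k2) @ \oo)).
    have : (fun n => k0 * (u n * u n) + k1 * u n + k2) @ \oo -->
        k0 * (0 * 0) + k1 * 0 + k2.
      apply: cvgD => //; apply: cvgD; last exact: cvgM.
      by apply: cvgM => //; exact: cvgM.
    by rewrite !mulr0 !add0r.
  apply: (@squeeze_cvgr _ _ _ _ (fun=> 0) (fun n => A * (v n * u n))) => //.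
    near=> n; have /andP[lo hi] : B * 2 ^+ n * (q ^+ n) ^+ 2 <=
      k0 * (q ^+ n) ^+ 2 + k1 * q ^+ n + k2 <= A * 2 ^+ n * (q ^+ n) ^+ 2.
      by near: n.
    apply/andP; split.
      by apply: le_trans lo; rewrite !mulr_ge0 ?exprn_ge0 ?ltW.
    by apply: le_trans hi _; rewrite vE /u expr2 !mulrA.
  have : (fun n => A * (v n * u n)) @ \oo --> A * (0 * 0).
    by apply: cvgM => //; exact: cvgM.
  by rewrite !mulr0.
(* Same squeezing after division by q^n. *)
have k1E : k1 = 0.
  apply: (@cvg_unique _ (@norm_hausdorff _ R) ((fun n => k0 * u n + k1) @ \oo)).
    have : (fun n => k0 * u n + k1) @ \oo --> k0 * 0 + k1.
      by apply: cvgD => //; exact: cvgM.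
    by rewrite mulr0 add0r.
  apply: (@squeeze_cvgr _ _ _ _ (fun=> 0) (fun n => A * v n)) => //.
    near=> n; have /andP[lo hi] : B * 2 ^+ n * (q ^+ n) ^+ 2 <=
      k0 * (q ^+ n) ^+ 2 + k1 * q ^+ n + k2 <= A * 2 ^+ n * (q ^+ n) ^+ 2.
      by near: n.
    have E : k0 * (q ^+ n) ^+ 2 + k1 * q ^+ n + k2 = (k0 * u n + k1) * u n.
      by rewrite k2E /u; ring.
    rewrite E in lo hi; apply/andP; split.
      rewrite -(pmulr_lge0 _ (u0 n)); apply: le_trans lo.
      by rewrite !mulr_ge0 ?exprn_ge0 ?ltW.
    rewrite -(ler_pM2r (u0 n)); apply: le_trans hi _; rewrite vE /u.
    by rewrite le_eqVlt; apply/orP; left; apply/eqP; ring.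
  have : (fun n => A * v n) @ \oo --> A * 0 by exact: cvgM.
  by rewrite mulr0.
near \oo => n.
have /andP[lo _] : B * 2 ^+ n * (q ^+ n) ^+ 2 <=
    k0 * (q ^+ n) ^+ 2 + k1 * q ^+ n + k2 <= A * 2 ^+ n * (q ^+ n) ^+ 2.
  by near: n.
have nk : k0 / B < n%:R by near: n; exact: nbhs_infty_gtr.
rewrite k1E k2E mul0r !addr0 ler_pM2r ?exprn_gt0// in lo.
have : n%:R <= 2 ^+ n :> R by rewrite -natrX ler_nat ltnW// ltn_expl.
move: nk; rewrite ltr_pdivrMr// => nk np.
have : B * n%:R <= B * 2 ^+ n by rewrite ler_pM2l.
lra.
Unshelve. all: by end_near. Qed.

(** * The Cantor set of ratio q on the line *)

Fixpoint left_ends (R : realType) (q : R) (n : nat) : seq R :=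
  if n is m.+1 then
    [seq q * a | a <- left_ends q m] ++ [seq q * a + (1 - q) | a <- left_ends q m]
  else [:: 0].

Lemma size_left_ends (R : realType) (q : R) n : size (left_ends q n) = (2 ^ n)%N.
Proof.
by elim: n => // n IH; rewrite /= size_cat !size_map IH expnS mul2n addnn.
Qed.

Lemma left_ends_bounds (R : realType) (q : R) n a :
  0 <= q -> q <= 1 -> a \in left_ends q n -> 0 <= a <= 1 - q ^+ n.
Proof.
move=> q0 q1; elim: n a => [|n IH] a.
  by rewrite inE => /eqP->; rewrite expr0 subrr lexx.
have qn : 0 <= q ^+ n by exact: exprn_ge0.
rewrite /= mem_cat exprS => /orP[] /mapP[b /IH /andP[b0 b1] ->];
  have h0 := mulr_ge0 q0 b0; have : q * b <= q * (1 - q ^+ n) by rewrite ler_wpM2l.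
- by move=> h1; apply/andP; split; lra.
- by move=> h1; apply/andP; split; lra.
Qed.

(** Within each half the spacing is inherited by scaling; the two halves are
    separated because q <= 1 - q. *)
Lemma left_ends_separated (R : realType) (q : R) n : 0 <= q -> q <= 2^-1 ->
  pairwise (fun a b => a + q ^+ n <= b) (left_ends q n).
Proof.
move=> q0 q2; elim: n => // n IH.
rewrite /= pairwise_cat !pairwise_map; apply/and3P; split.
- apply/allrelP => _ _ /mapP[a aL ->] /mapP[b bL ->].
  have q1 : q <= 1 by lra.
  have /andP[_ a1] := left_ends_bounds q0 q1 aL.
  have /andP[b0 _] := left_ends_bounds q0 q1 bL.
  have : q * a <= q * (1 - q ^+ n) by rewrite ler_wpM2l.
  have := mulr_ge0 q0 b0.
  by rewrite exprS; lra.
- apply: sub_pairwise IH => a b ab; rewrite /= exprS -mulrDr.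
  by rewrite ler_wpM2l.
- apply: sub_pairwise IH => a b ab; rewrite /= exprS addrAC lerD2r -mulrDr.
  by rewrite ler_wpM2l.
Qed.

Definition cantor_subinvariant (R : realType) (q : R) (P : set R) : Prop :=
  forall x, P x -> exists2 y, P y & x = q * y \/ x = q * y + (1 - q).

(** The extreme points m of [P] satisfy m >= q m, respectively
    m <= q m + (1 - q), which solve to m >= 0 and m <= 1. *)
Lemma cantor_bounds (R : realType) (q : R) (P : set R) :
  0 <= q -> q < 1 -> compact P -> cantor_subinvariant q P ->
  forall x, P x -> 0 <= x <= 1.
Proof.
move=> q0 q1 cP sP x Px.
have P0 : P !=set0 by exists x.
have cid : {within P, continuous (idfun : R -> R)}.
  by apply: continuous_subspaceT => y; exact: cvg_id.
apply/andP; split.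
- have [m /set_mem Pm min_m] := compact_EVT_min P0 cP cid.
  rewrite (le_trans _ (min_m x (mem_set Px)))//=.
  have [y Py my] := sP m Pm.
  have ym : q * m <= q * y by rewrite ler_wpM2l// (min_m y (mem_set Py)).
  have : 0 <= (1 - q) * m by case: my => my; lra.
  by rewrite pmulr_rge0// subr_gt0.
- have [m /set_mem Pm max_m] := compact_EVT_max P0 cP cid.
  rewrite (le_trans (max_m x (mem_set Px)))//=.
  have [y Py my] := sP m Pm.
  have ym : q * y <= q * m by rewrite ler_wpM2l// (max_m y (mem_set Py)).
  have : 0 <= (1 - q) * (1 - m) by case: my => my; lra.
  by rewrite pmulr_rge0 ?subr_gt0// subr_ge0.
Qed.

Lemma cantor_cover (R : realType) (q : R) (P : set R) n x :
  0 <= q -> (forall x, P x -> 0 <= x <= 1) -> cantor_subinvariant q P -> P x ->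
  exists2 a, a \in left_ends q n & a <= x <= a + q ^+ n.
Proof.
move=> q0 bP sP; elim: n x => [|n IH] x Px.
  by exists 0; rewrite ?inE//= expr0 add0r; exact: bP.
have [y /IH[a aL /andP[ay ya]] xy] := sP x Px.
have h1 : q * a <= q * y by rewrite ler_wpM2l.
have h2 : q * y <= q * (a + q ^+ n) by rewrite ler_wpM2l.
case: xy => ->.
- exists (q * a); first by rewrite /= mem_cat map_f.
  by rewrite exprS; apply/andP; split; lra.
- exists (q * a + (1 - q)).
    by rewrite /= mem_cat; apply/orP; right; apply/mapP; exists a.
  by rewrite exprS; apply/andP; split; lra.
Qed.

(** * The gap of the dust and the position of the attractor *)

(** The union of the four image squares is the product of this set with
    itself, see [dust_map_square]. *)
Definition corner_strips (R : realType) (q : R) : set R :=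
  `]0, q[%classic `|` `]1 - q, 1[%classic.

Lemma dust_mapE (R : realType) (r : R) (i : 'I_4) (x : R * R) : r != 0 ->
  dust_map r i x =
  (r^-1 * x.1 + (if (i == 1 :> nat) || (i == 2 :> nat) then 1 - r^-1 else 0),
   r^-1 * x.2 + (if (i == 2 :> nat) || (i == 3 :> nat) then 1 - r^-1 else 0)).
Proof.
move=> r0; have tE : (r - 1) / r = 1 - r^-1 by field.
by rewrite /dust_map tE; case: i => -[|[|[|[|//]]]].
Qed.

Lemma dust_map_square (R : realType) (r : R) : 2 < r ->
  ifs_union (dust_map r) (open_unit_square R) =
  corner_strips r^-1 `*` corner_strips r^-1.
Proof.
move=> r2; have r0 : 0 < r by lra.
have rn0 : r != 0 by lra.
have q0 : 0 < r^-1 by rewrite invr_gt0.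
apply/seteqP; split.
  have H x : 0 < x < 1 -> 0 < r^-1 * x < r^-1.
    by case/andP => x0 x1; rewrite mulr_gt0//= gtr_pMr.
  move=> _ [i _ [[x y] + <-]]; rewrite dust_mapE// => -[/=].
  rewrite !in_itv /= => /H /andP[x0 x1] /H /andP[y0 y1]; split=> /=.
  - by case: ifP => _; [right|left]; rewrite /= in_itv /=; apply/andP; split; lra.
  - by case: ifP => _; [right|left]; rewrite /= in_itv /=; apply/andP; split; lra.
move=> [x y] [/= xT yT].
have H z : corner_strips r^-1 z -> exists (b : bool) (w : R),
    0 < w < 1 /\ z = r^-1 * w + (if b then 1 - r^-1 else 0).
  case; rewrite /= in_itv /= => /andP[z0 z1].
  - exists false, (r * z); rewrite mulr_gt0//= addr0 mulKf//; split => //.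
    by rewrite mulrC -ltr_pdivlMr// mul1r.
  - exists true, (r * (z - (1 - r^-1))).
    rewrite mulr_gt0 ?subr_gt0//= mulKf// subrK; split => //.
    by rewrite mulrC -ltr_pdivlMr// mul1r; lra.
have [[b [w [wI ->]]] [c [w' [w'I ->]]]] := (H x xT, H y yT).
have [i [bi ci]] : exists i : 'I_4,
    ((i == 1 :> nat) || (i == 2 :> nat)) = b /\
    ((i == 2 :> nat) || (i == 3 :> nat)) = c.
  by case: b c => -[]; [ exists (inord 2) | exists (inord 1) | exists (inord 3)
                       | exists (inord 0)]; rewrite !inordK.
by exists i => //; exists (w, w') => //; rewrite dust_mapE// bi ci.
Qed.

Lemma ratio_bounds (R : realType) (r : R) : 2 < r -> 0 < r^-1 < 2^-1.
Proof.
by move=> r2; have r0 : 0 < r by [lra]; rewrite invr_gt0 r0 ltf_pV2 ?posrE.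
Qed.

Lemma coordinate_cantor (R : realType) (r : R) (C : set (R * R))
    (f : R * R -> R) : 2 < r -> attractor (dust_map r) C ->
  f = fst \/ f = snd -> cantor_subinvariant r^-1 (f @` C).
Proof.
move=> r2 [_ _ CE] fE _ [x Cx <-]; move: Cx; rewrite {1}CE => -[i _ [y Cy <-]].
have rn0 : r != 0 by lra.
exists (f y); first by exists y.
rewrite dust_mapE//.
by case: fE => -> /=; case: ifP => _; rewrite ?addr0; [right|left|right|left].
Qed.

Lemma coordinate_bounds (R : realType) (r : R) (C : set (R * R))
    (f : R * R -> R) : 2 < r -> attractor (dust_map r) C ->
  f = fst \/ f = snd -> forall z, (f @` C) z -> 0 <= z <= 1.
Proof.
move=> r2 hC fE; have /andP[q0 q2] := ratio_bounds r2.
have cf : continuous f by case: fE => -> z; [exact: cvg_fst|exact: cvg_snd].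
apply: (@cantor_bounds _ r^-1); [exact: ltW|lra| |exact: coordinate_cantor].
by case: hC => _ cC _; apply: continuous_compact => //; exact: continuous_subspaceT.
Qed.

Lemma eucl_norm_ge_coord (R : realType) (x : R * R) :
  `|x.1| <= eucl_norm x /\ `|x.2| <= eucl_norm x.
Proof.
by rewrite -!sqrtr_sqr /eucl_norm; split; rewrite ler_sqrt ?addr_ge0 ?sqr_ge0//
  ?lerDl ?lerDr sqr_ge0.
Qed.

Lemma eucl_norm_le_sum (R : realType) (x : R * R) :
  eucl_norm x <= `|x.1| + `|x.2|.
Proof.
rewrite -[leRHS]ger0_norm ?addr_ge0// -sqrtr_sqr /eucl_norm ler_sqrt ?sqr_ge0//.
rewrite sqrrD !real_normK ?num_real// lerD2r lerDl.
by rewrite mulrn_wge0// mulr_ge0.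
Qed.

(** The map [dust_map r i] moves every point but [p] closer to [p], so a
    point of [C] nearest to [p] can only be [p]. *)
Lemma dust_fixed_point (R : realType) (r : R) (C : set (R * R)) (i : 'I_4)
    (p : R * R) :
  2 < r -> attractor (dust_map r) C -> dust_map r i p = p -> C p.
Proof.
move=> r2 [C0 cC CE] fp; have /andP[q0 q2] := ratio_bounds r2.
have rn0 : r != 0 by lra.
have [c Cc [_ cmin]] := eucl_dist_attained p C0 cC.
have Cd : C (dust_map r i c) by rewrite CE; exists i => //; exists c.
have E : p - dust_map r i c = (r^-1 * (p - c).1, r^-1 * (p - c).2).
  by rewrite -{1}fp !dust_mapE//; congr (_, _) => /=; ring.
have nE : eucl_norm (p - dust_map r i c) = r^-1 * eucl_norm (p - c).
  rewrite E /eucl_norm /= !exprMn -mulrDr sqrtrM ?sqr_ge0//.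
  by rewrite sqrtr_sqr ger0_norm// ltW.
have n0 : 0 <= eucl_norm (p - c) by exact: sqrtr_ge0.
have : eucl_norm (p - c) <= 0.
  have := cmin _ Cd; rewrite nE => h.
  have : (1 - r^-1) * eucl_norm (p - c) <= 0 by lra.
  by rewrite pmulr_rle0//; lra.
have [h1 h2] := eucl_norm_ge_coord (p - c) => n_le0.
have := le_trans h1 n_le0; have := le_trans h2 n_le0.
rewrite !normr_le0 => /eqP /= /subr0_eq p2 /eqP /= /subr0_eq p1.
by rewrite (_ : p = c)//; case: (p) (c) p1 p2 => ? ? [? ?] /= -> ->.
Qed.

(** The maps of index 1 and 2 preserve the line x = 1, on which they act as the
    two contractions of the Cantor set; the induction starts at (1, 0), the
    fixed point of the map of index 1. *)
Lemma dust_right_edge (R : realType) (r : R) (C : set (R * R)) n a :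
  2 < r -> attractor (dust_map r) C -> a \in left_ends r^-1 n -> C (1, a).
Proof.
move=> r2 hC; have rn0 : r != 0 by lra.
have CS i x : C x -> C (dust_map r i x).
  by case: hC => _ _ {2}-> Cx; exists i => //; exists x.
elim: n a => [|n IH] a.
  rewrite inE => /eqP ->; apply: (@dust_fixed_point _ r _ (inord 1)) => //.
  by rewrite dust_mapE// !inordK//=; congr (_, _); ring.
rewrite /= mem_cat => /orP[] /mapP[b /IH Cb ->].
- rewrite (_ : (1, _) = dust_map r (inord 1) (1, b)); first exact: CS.
  by rewrite dust_mapE// !inordK//=; congr (_, _); ring.
- rewrite (_ : (1, _) = dust_map r (inord 2) (1, b)); first exact: CS.
  by rewrite dust_mapE// !inordK//=; congr (_, _); ring.
Qed.

(** The maps of index 0 and 3 carry the right edge of the square to the left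
    side x = q of the central vertical strip. *)
Lemma dust_gap_edge (R : realType) (r : R) (C : set (R * R)) n a :
  2 < r -> attractor (dust_map r) C -> a \in left_ends r^-1 n.+1 -> C (r^-1, a).
Proof.
move=> r2 hC; have rn0 : r != 0 by lra.
have CS i x : C x -> C (dust_map r i x).
  by case: hC => _ _ {2}-> Cx; exists i => //; exists x.
rewrite /= mem_cat => /orP[] /mapP[b /(dust_right_edge r2 hC) Cb ->].
- rewrite (_ : (r^-1, _) = dust_map r (inord 0) (1, b)); first exact: CS.
  by rewrite dust_mapE// !inordK//=; congr (_, _); ring.
- rewrite (_ : (r^-1, _) = dust_map r (inord 3) (1, b)); first exact: CS.
  by rewrite dust_mapE// !inordK//=; congr (_, _); ring.
Qed.

(** * Measurability of the parallel set in the gap *)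

Lemma compact_eucl_disc (R : realType) (e : R) :
  compact [set v : R * R | eucl_norm v <= e].
Proof.
apply: (@subclosed_compact _ _ (`[- e, e]%classic `*` `[- e, e]%classic)).
- have cn : continuous (@eucl_norm R).
    move=> v; apply: (@continuous_comp _ _ _
      (fun w : R * R => w.1 * w.1 + w.2 * w.2) Num.sqrt); last exact: sqrt_continuous.
    by apply: cvgD; apply: cvgM; (exact: cvg_fst || exact: cvg_snd).
  have -> : [set v : R * R | eucl_norm v <= e] = @eucl_norm R @^-1` [set x | x <= e].
    by [].
  by apply: preimage_closed => [v _|]; [exact: cn|exact: closed_le].
- by apply: compact_setX; exact: segment_compact.
- move=> v /= ve; have [h1 h2] := eucl_norm_ge_coord v.
  by split; rewrite /= in_itv /= -ler_norml; [exact: le_trans h1 ve|exact: le_trans h2 ve].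
Qed.

(** The parallel set is the Minkowski sum of two compact sets, [C] and a disc. *)
Lemma closed_parallel_set (R : realType) (C : set (R * R)) (e : R) :
  C !=set0 -> compact C -> closed (parallel_set C e).
Proof.
move=> C0 cC.
have -> : parallel_set C e =
    (fun p : (R * R) * (R * R) => p.1 + p.2) @`
      (C `*` [set v : R * R | eucl_norm v <= e]).
  apply/seteqP; split => [x /= xe|_ [[a v] [/= Ca ve] <-]].
    have [a Ca [ax _]] := eucl_dist_attained x C0 cC.
    by exists (a, x - a); [split; rewrite //= -ax|rewrite /= addrC subrK].
  have [b Cb [bx bmin]] := eucl_dist_attained (a + v) C0 cC.
  by rewrite /parallel_set /= bx (le_trans (bmin _ Ca))// addrAC subrr add0r.
apply: compact_closed; first exact: norm_hausdorff.
apply: continuous_compact.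
  apply: continuous_subspaceT => p.
  by apply: cvgD; [exact: cvg_fst|exact: cvg_snd].
by apply: compact_setX => //; exact: compact_eucl_disc.
Qed.

Lemma measurable_parallel_gap (R : realType) (r : R) (C : set (R * R)) (e : R) :
  2 < r -> attractor (dust_map r) C ->
  measurable ((parallel_set C e `&` dust_gap r)
     : set (measurableTypeR R * measurableTypeR R)).
Proof.
move=> r2 [C0 cC _]; rewrite dust_map_square//.
have mT : measurable (corner_strips r^-1 : set (measurableTypeR R)).
  by apply: measurableU; exact: measurable_itv.
apply: measurableI.
  have /open_measurable2 : open (~` parallel_set C e).
    by apply: closed_openC; exact: closed_parallel_set.
  by move/measurableC; rewrite setCK.
apply: measurableD; last exact: measurableX.
by apply: measurableX; exact: measurable_itv.
Qed.

(** * Two-sided bound on the parallel area in the gap *)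

(** With m = n + 1 and u = q^m, the 2^m disjoint open squares of side u with lower
    left corners (q, a), a in [left_ends q m], fit in the set.  The hypothesis
    u < 1 - 2 q keeps them inside the central vertical strip.  The level is a
    successor because [dust_gap_edge] obtains (q, a) as the image of a point of
    the right edge, which belongs to the preceding level. *)
Lemma parallel_gap_area_ge (R : realType) (r : R) (C : set (R * R)) n :
  2 < r -> attractor (dust_map r) C -> r^-1 ^+ n.+1 < 1 - 2 * r^-1 ->
  ((2 ^+ n.+1 * (r^-1 ^+ n.+1) ^+ 2)%:E <=
  lebesgue2 (parallel_set C (2 * r^-1 ^+ n.+1) `&` dust_gap r))%E.
Proof.
move=> r2 hC; have /andP[q0 q2] := ratio_bounds r2.
have mG := measurable_parallel_gap (2 * r^-1 ^+ n.+1) r2 hC.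
move: mG; rewrite dust_map_square//.
set q := r^-1 in q0 q2 *; set u := q ^+ n.+1 => mG u_small.
have u0 : 0 < u by exact: exprn_gt0.
pose I : set (measurableTypeR R) := `]q, q + u[%classic.
pose V : set (measurableTypeR R) :=
  \big[setU/set0]_(a <- left_ends q n.+1) `]a, a + u[%classic.
have mI : measurable I by exact: measurable_itv.
have mV : measurable V by apply: measurable_bigsetU_seq => a; exact: measurable_itv.
have -> : (2 ^+ n.+1 * u ^+ 2)%:E = lebesgue2 (I `*` V).
  rewrite lebesgue2X// /I /V lebesgue_separated_itv//; last first.
    by apply: left_ends_separated; exact: ltW.
  rewrite size_left_ends lebesgue_measure_itv /= lte_fin ltrDl u0 -EFinD -EFinM.
  by congr EFin; rewrite natrX; ring.
apply: le_measure; rewrite ?inE//; first exact: measurableX.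
move=> [x y] [/=]; rewrite /I /V -bigcup_seq /= in_itv /= => /andP[qx xq].
case=> a /= aL; rewrite in_itv /= => /andP[ay ya].
have Ca := dust_gap_edge r2 hC aL.
have q1 : q <= 1 by lra.
have /andP[a0 a1] := @left_ends_bounds _ q n.+1 a (ltW q0) q1 aL; rewrite -/u in a1.
split.
  case: (hC) => C0 cC _.
  have [b _ [bE bmin]] := eucl_dist_attained (x, y) C0 cC.
  rewrite /parallel_set /= bE; apply: le_trans (bmin _ Ca) _.
  apply: le_trans (eucl_norm_le_sum _) _.
  rewrite /= -/q !ger0_norm ?subr_ge0 ?(ltW qx) ?(ltW ay)//.
  lra.
split.
  by split; rewrite /= in_itv /=; apply/andP; split; lra.
case=> /= + _; rewrite /corner_strips /= !in_itv /= => -[] /andP[]; rewrite -/q; lra.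
Qed.

(** The segment from [x] to [a] passes through q or through 1 - q. *)
Lemma gap_side_near (R : realType) (q e x a : R) :
  q <= x <= 1 - q -> a <= q \/ 1 - q <= a -> `|x - a| <= e ->
  x \in `[q - e, q + e] \/ x \in `[1 - q - e, 1 - q + e].
Proof.
rewrite ler_norml !in_itv /= => /andP[x0 x1] aq /andP[h1 h2].
by case: aq => aq; [left|right]; apply/andP; split; lra.
Qed.

(** The set is covered by E x V and V x E, where E is the 2u-neighbourhood of
    the two endpoints q and 1 - q, of length at most 8u, and V the
    2u-neighbourhood of the n-th stage, of length at most 5u 2^n.  This gives
    the constant 80 = 2 * 8 * 5. *)
Lemma parallel_gap_area_le (R : realType) (r : R) (C : set (R * R)) n :
  2 < r -> attractor (dust_map r) C ->
  (lebesgue2 (parallel_set C (2 * r^-1 ^+ n) `&` dust_gap r) <=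
   (80 * 2 ^+ n * (r^-1 ^+ n) ^+ 2)%:E)%E.
Proof.
move=> r2 hC; have /andP[q0 q2] := ratio_bounds r2.
have mG := measurable_parallel_gap (2 * r^-1 ^+ n) r2 hC.
move: mG; rewrite dust_map_square//.
have := coordinate_cantor r2 hC; have := coordinate_bounds r2 hC.
set q := r^-1 in q0 q2 *; set u := q ^+ n => bnd cant mG.
have u0 : 0 < u by exact: exprn_gt0.
pose E : set (measurableTypeR R) :=
  `[q - 2 * u, q + 2 * u]%classic `|` `[1 - q - 2 * u, 1 - q + 2 * u]%classic.
pose V : set (measurableTypeR R) :=
  \big[setU/set0]_(a <- left_ends q n) `[a - 2 * u, a + 3 * u]%classic.
have mE : measurable E by apply: measurableU; exact: measurable_itv.
have mV : measurable V by apply: measurable_bigsetU_seq => a; exact: measurable_itv.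
have E_le : (lebesgue_measure E <= (8 * u)%:E)%E.
  have H c : lebesgue_measure `[c - 2 * u, c + 2 * u]%classic = (4 * u)%:E.
    rewrite lebesgue_measure_itv /= lte_fin ifT; last lra.
    by rewrite -EFinD; congr EFin; ring.
  rewrite (_ : 8 * u = 4 * u + 4 * u); last ring.
  rewrite EFinD -{1}(H q) -(H (1 - q)).
  by apply: measureU2; exact: measurable_itv.
have V_le : (lebesgue_measure V <= (2 ^+ n * (5 * u))%:E)%E.
  have H a : (lebesgue_measure `[(a - 2 * u)%R, (a + 3 * u)%R]%classic <= (5 * u)%:E)%E.
    rewrite lebesgue_measure_itv /= lte_fin ifT; last lra.
    by rewrite -EFinD lee_fin; lra.
  rewrite -natrX -(size_left_ends q).
  by apply: measure_bigsetU_seq_le => a; [exact: measurable_itv|exact: H].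
have inV (f : R * R -> R) z c : f = fst \/ f = snd -> C c -> `|z - f c| <= 2 * u -> V z.
  move=> fE Cc; have Pc : (f @` C) (f c) by exists c.
  have [a aL /andP[h1 h2]] := cantor_cover n (ltW q0) (bnd f fE) (cant f fE) Pc.
  rewrite ler_norml => /andP[h3 h4]; apply: (mem_bigsetU_seq aL).
  by rewrite /= in_itv /= -/u; rewrite -/u in h2; apply/andP; split; lra.
have inE_near (f : R * R -> R) z c : f = fst \/ f = snd -> C c ->
    q <= z <= 1 - q -> `|z - f c| <= 2 * u -> E z.
  move=> fE Cc qz zc; apply: (@gap_side_near _ q (2 * u) z (f c)) => //.
  have Pc : (f @` C) (f c) by exists c.
  have [y /(bnd f fE)/andP[y0 y1]] := cant f fE _ Pc.
  have h0 := mulr_ge0 (ltW q0) y0; have h1 : q * y <= q by rewrite ger_pMr.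
  by case=> ->; [left|right]; lra.
have sub : parallel_set C (2 * u) `&` (open_unit_square R `\`
    corner_strips q `*` corner_strips q) `<=` (E `*` V) `|` (V `*` E).
  move=> [x y] [/= xe [[/= + +] nT]]; rewrite !in_itv /= => /andP[x0 x1] /andP[y0 y1].
  case: (hC) => C0 cC _.
  have [c Cc [cE _]] := eucl_dist_attained (x, y) C0 cC.
  have [h1 h2] := eucl_norm_ge_coord ((x, y) - c).
  rewrite /parallel_set /= cE in xe.
  have {}h1 : `|x - c.1| <= 2 * u by exact: le_trans h1 xe.
  have {}h2 : `|y - c.2| <= 2 * u by exact: le_trans h2 xe.
  have strip z : 0 < z -> z < 1 -> ~ corner_strips q z -> q <= z <= 1 - q.
    move=> z0 z1 nz; apply/andP; split; rewrite leNgt; apply/negP => zq; apply: nz.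
      by left; rewrite /= in_itv /= z0.
    by right; rewrite /= in_itv /= zq.
  have [xT|/(strip _ x0 x1) xq] := pselect (corner_strips q x).
    have /(strip _ y0 y1) yq : ~ corner_strips q y by move=> yT; exact: nT.
    by right; split; [apply: (inV fst _ c)|apply: (inE_near snd _ c)] => //; [left|right].
  by left; split; [apply: (inE_near fst _ c)|apply: (inV snd _ c)] => //; [left|right].
apply: (@le_trans _ _ (lebesgue2 ((E `*` V) `|` (V `*` E)))).
  apply: le_measure; rewrite ?inE//.
  by apply: measurableU; exact: measurableX.
apply: (@le_trans _ _ (lebesgue2 (E `*` V) + lebesgue2 (V `*` E))%E).
  by apply: measureU2; exact: measurableX.
rewrite !lebesgue2X// [X in (_ + X)%E]muleC.
have EV : (lebesgue_measure E * lebesgue_measure V <=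
    (8 * u * (2 ^+ n * (5 * u)))%:E)%E.
  by rewrite EFinM lee_pmul.
apply: (le_trans (leeD EV EV)); rewrite -EFinD lee_fin.
by rewrite le_eqVlt; apply/orP; left; apply/eqP; ring.
Qed.

(** * Conclusion *)

(** On (0, a_1] only the first term of the defining sum survives. *)
Lemma pluriphase_near0 (R : realType) (F Gamma : set (R * R)) :
  pluriphase F Gamma -> exists (e0 k0 k1 k2 : R), 0 < e0 /\
    forall e, 0 < e <= e0 ->
      lebesgue2 (parallel_set F e `&` Gamma) = (k0 * e ^+ 2 + k1 * e + k2)%:E.
Proof.
move=> [M [a [kappa [M0 a0 amono _ areaE]]]].
have a_ge j i : (i <= j)%N -> (j <= M)%N -> a i <= a j.
  elim: j => [|j IH]; first by rewrite leqn0 => /eqP ->.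
  rewrite leq_eqVlt => /orP[/eqP -> //|]; rewrite ltnS => ij jM.
  by rewrite (le_trans (IH ij (ltnW jM)))// ltW// amono.
exists (a 1%N), (kappa 1%N 0%N), (kappa 1%N 1%N), (kappa 1%N 2%N); split.
  by rewrite -a0; exact: amono.
move=> e /andP[e0 ea]; rewrite areaE// big_ltn ?ltnS//.
rewrite [\sum_(2 <= m < M.+1) _]big1_seq ?addr0; last first.
  move=> m /andP[_]; rewrite mem_index_iota ltnS => /andP[m2 mM].
  rewrite indicE memNset ?mul0r//= in_itv /= => /andP[+ _].
  rewrite ltNge => /negP; apply; apply: le_trans ea _; apply: a_ge.
    by rewrite -ltnS prednK// ltnW.
  by rewrite (leq_trans (leq_pred _)).
rewrite indicE mem_set /=; last by rewrite in_itv /= a0 e0.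
rewrite indicE memNset /=; last first.
  by rewrite in_itv /= andbT ltNge => /negP; apply; apply: le_trans ea _; exact: a_ge.
rewrite mul0e adde0 mul1r big_ltn// big_ltn// big_ltn// big_geq//.
by congr EFin; rewrite !subn0 /= subnn expr0; ring.
Qed.

Theorem proposition3p1 (R : realType) (r : R) (hr : 2 < r)
    (C : set (R * R)) (hC : attractor (dust_map r) C) :
  ~ pluriphase C
      (open_unit_square R `\` ifs_union (dust_map r) (open_unit_square R)).
Proof.
move=> /pluriphase_near0 [e0 [k0 [k1 [k2 [e0_gt0 areaE]]]]].
have /andP[q0 q2] := ratio_bounds hr.
have cq : (fun n => r^-1 ^+ n) @ \oo --> (0 : R).
  by apply: cvg_expr; rewrite gtr0_norm//; lra.
apply: (@quadratic_not_between _ r^-1 80 1 (4 * k0) (2 * k1) k2) => //; near=> n.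
have u0 : 0 < r^-1 ^+ n by exact: exprn_gt0.
have u_small : r^-1 ^+ n < 1 - 2 * r^-1.
  by near: n; apply: (cvgr_lt _ cq); lra.
have u_e0 : r^-1 ^+ n < e0 / 2 by near: n; apply: (cvgr_lt _ cq); lra.
have -> : 4 * k0 * (r^-1 ^+ n) ^+ 2 + 2 * k1 * r^-1 ^+ n + k2 =
  k0 * (2 * r^-1 ^+ n) ^+ 2 + k1 * (2 * r^-1 ^+ n) + k2 by ring.
rewrite -!lee_fin -areaE; last by apply/andP; split; lra.
rewrite parallel_gap_area_le// andbT mul1r.
have n_gt0 : (0 < n)%N by near: n; exact: nbhs_infty_gt.
have := @parallel_gap_area_ge R r C n.-1 hr hC; rewrite prednK//; exact.
Unshelve. all: by end_near. Qed.
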